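(* Let $A\in\mathbb{C}^{n\times n}$ be normal, let $v,w\in\mathbb{C}^n$, $y\in\mathbb{C}$, and put $$A_+=\begin{bmatrix} A & v\\ w^* & y\end{bmatrix}\in\mathbb{C}^{(n+1)\times(n+1)}.$$ Then $A_+$ is normal if and only if there is a $\theta\in\mathbb{T}_U$ such that the following holds, where $\ell=\{y+\rho\theta:\rho\in\mathbb{R}\}$ and $p\in\{0,\dots,n\}$ is the number of eigenvalues of $A$ (counted with multiplicity) on $\ell$: there exist a unitary $U\in\mathbb{C}^{n\times n}$ whose columns are eigenvectors of $A$ and a vector $r\in\mathbb{C}^p$ with $$\begin{bmatrix}U&\\&1\end{bmatrix}^*A_+\begin{bmatrix}U&\\&1\end{bmatrix}=\begin{bmatrix}B&&\\&\Lambda_p&\theta r\\&\theta r^*&y\end{bmatrix},$$ where $B$ is diagonal of size $(n-p)\times(n-p)$, and $\Lambda_p=\theta R+yI_p$ with $R$ real diagonal is the diagonal matrix containing the $p$ eigenvalues of $A$ that lie on $\ell$. In that case $n-p$ eigenvalues of $A$ (those of $B$) are also eigenvalues of $A_+$, and the $p+1$ eigenvalues of $A_+$ that remain lie on $\ell$ and are interlaced by the remaining $p$ eigenvalues of $A$: writing the latter as $y+\theta r_1,\dots,y+\theta r_p$ with real $r_1\le\dots\le r_p$, the remaining eigenvalues of $A_+$ are $y+\theta s_1,\dots,y+\theta s_{p+1}$ with real $s_j$ satisfying $s_1\le r_1\le s_2\le r_2\le\dots\le r_p\le s_{p+1}$.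
   Context: $\mathbb{T}_U=\{\tau\in\mathbb{C}:|\tau|=1,\ \arg(\tau)\in[0,\pi)\}$. Empty blocks in matrices are zero blocks. Blocks of size $0$ are allowed (for $p=0$ the block $\Lambda_p$ and the vector $r$ are absent). Eigenvalues are counted with multiplicity. *)

(* Defs.v *)
From HB Require Import structures.
From mathcomp Require Export all_boot all_order all_algebra reals complex.
From mathcomp Require Import boolp classical_sets trigo.

Set Implicit Arguments.
Unset Strict Implicit.
Unset Printing Implicit Defensive.

Import Order.TTheory GRing.Theory Num.Theory.
Local Open Scope classical_set_scope.
Local Open Scope ring_scope.
Local Open Scope complex_scope.
Local Open Scope sesquilinear_scope.

(* A real t is an argument of tau when tau = |tau| (cos t + i sin t); for
   tau != 0 there is at most one such t in [0, pi), so the second conjunct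
   says that arg tau exists in [0, pi). *)
Definition TU (R : realType) : set R[i] :=
  [set tau | `|tau| = 1 /\
     exists2 t : R, 0 <= t < trigo.pi & tau = `|tau| * (cos t +i* sin t)].

Definition line (R : realType) (y theta : R[i]) : set R[i] :=
  [set z | exists rho : R, z = y + rho%:C * theta].

(* The roots of the characteristic polynomial, each repeated according to its
   algebraic multiplicity; the order of the sequence carries no meaning. *)
Definition eigenvals (R : realType) (n : nat) (A : 'M[R[i]]_n) : seq R[i] :=
  sval (closed_field_poly_normal (char_poly A)).

Lemma eigenvalsE (R : realType) (n : nat) (A : 'M[R[i]]_n) :
  char_poly A = \prod_(z <- eigenvals A) ('X - z%:P).
Proof.
rewrite /eigenvals; case: closed_field_poly_normal => s /= {1}->.
by rewrite (monicP (char_poly_monic A)) scale1r.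
Qed.

Lemma size_eigenvals (R : realType) (n : nat) (A : 'M[R[i]]_n) :
  size (eigenvals A) = n.
Proof.
by apply: succn_inj; rewrite -(size_char_poly A) eigenvalsE size_prod_XsubC.
Qed.

Definition line_eigenvals (R : realType) (n : nat) (A : 'M[R[i]]_n)
    (y theta : R[i]) : seq R[i] :=
  [seq z <- eigenvals A | z \in line y theta].

Definition nb_line (R : realType) (n : nat) (A : 'M[R[i]]_n)
    (y theta : R[i]) : nat :=
  size (line_eigenvals A y theta).

Lemma nb_line_le (R : realType) (n : nat) (A : 'M[R[i]]_n) (y theta : R[i]) :
  (nb_line A y theta <= n)%N.
Proof. by rewrite /nb_line size_filter -{2}(size_eigenvals A) count_size. Qed.

Definition bordered (R : realType) (n : nat) (A : 'M[R[i]]_n)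
    (v w : 'cV[R[i]]_n) (y : R[i]) : 'M[R[i]]_(n + 1) :=
  block_mx A v (w ^t*) y%:M.

Definition is_eigenvector (R : realType) (n : nat) (A : 'M[R[i]]_n)
    (u : 'cV[R[i]]_n) : Prop :=
  u != 0 /\ exists a : R[i], A *m u = a *: u.

Definition Lambda (R : realType) (p : nat) (y theta : R[i]) (D : 'M[R]_p) :
    'M[R[i]]_p :=
  theta *: map_mx (real_complex R) D + y%:M.

Definition arrow (R : realType) (m p : nat) (y theta : R[i])
    (B : 'M[R[i]]_m) (D : 'M[R]_p) (r : 'cV[R[i]]_p) :
    'M[R[i]]_(m + p + 1) :=
  block_mx (block_mx B 0 0 (Lambda y theta D)) (col_mx 0 (theta *: r))
           (row_mx 0 (theta *: r ^t*))         y%:M.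

Lemma arrow_size (n p : nat) : (p <= n)%N -> (n - p + p + 1 = n + 1)%N.
Proof. by move=> le_pn; rewrite subnK. Qed.

Definition normal_form (R : realType) (n : nat) (A : 'M[R[i]]_n)
    (v w : 'cV[R[i]]_n) (y theta : R[i]) (U : 'M[R[i]]_n)
    (B : 'M[R[i]]_(n - nb_line A y theta)) (D : 'M[R]_(nb_line A y theta))
    (r : 'cV[R[i]]_(nb_line A y theta)) : Prop :=
  let e := arrow_size (nb_line_le A y theta) in
  let U1 : 'M[R[i]]_(n + 1) := block_mx U 0 0 1%:M in
  [/\ U \is unitarymx,
      forall j : 'I_n, is_eigenvector A (col j U),
      is_diag_mx B,
      is_diag_mx D /\
        perm_eq (eigenvals (Lambda y theta D)) (line_eigenvals A y theta)
    & U1 ^t* *m bordered A v w y *m U1 = castmx (e, e) (arrow y theta B D r)].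

(* s_0 <= r_0 <= s_1 <= r_1 <= ... <= r_(p-1) <= s_p *)
Definition interlaced (R : realType) (p : nat) (s : 'I_p.+1 -> R)
    (r : 'I_p -> R) : Prop :=
  forall j : 'I_p, s (widen_ord (leqnSn p) j) <= r j <= s (lift ord0 j).

(* Main.v *)
(* Comparing the diagonal blocks of the normality equation gives v v* = w w*,
   hence v = c w with |c| = 1.  For a square root theta of c with argument in
   [0, pi) one gets v = theta x and w* = theta x*.  In an eigenbasis of A the
   off-diagonal block then says that x_k = 0 unless (a_k - y) / theta is real,
   i.e. unless a_k lies on the line.  Ordering the basis with the eigenvalues on
   the line last yields the normal form, whose last block is theta H + y with
   H = [[R, r], [r*, 0]] Hermitian, and interlacing is Cauchy's theorem. *)
Require Import Defs.
From mathcomp Require Import perm classical_sets trigo ring.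
Import Order.TTheory GRing.Theory Num.Theory.
Local Open Scope ring_scope.
Local Open Scope complex_scope.
Local Open Scope sesquilinear_scope.

Set Implicit Arguments.
Unset Strict Implicit.
Unset Printing Implicit Defensive.

(** * Characteristic polynomials under casts, similarity and block sums *)

Section CharPoly.
Variable K : fieldType.

Lemma char_poly_castmx n m (e : n = m) (M : 'M[K]_n) :
  char_poly (castmx (e, e) M) = char_poly M.
Proof. by case: m / e; rewrite castmx_id. Qed.

(** Since the scalar X commutes with P, X - P M Q factors as P (X - M) Q, and the determinants of P
    and Q cancel. *)
Lemma char_poly_conj n (P Q M : 'M[K]_n) :
  Q *m P = 1%:M -> char_poly (P *m M *m Q) = char_poly M.
Proof.
move=> QP; have PQ := mulmx1C QP.
rewrite /char_poly.
have -> : char_poly_mx (P *m M *m Q) =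
    map_mx polyC P *m char_poly_mx M *m map_mx polyC Q.
  rewrite /char_poly_mx mulmxBr mulmxBl !map_mxM /=.
  rewrite scalar_mxC -[_%:M *m _ *m _]mulmxA.
  by rewrite -(map_mxM _ P Q) PQ map_mx1 mulmx1.
rewrite !det_mulmx mulrAC -det_mulmx -map_mxM PQ map_mx1 det1.
by rewrite mul1r.
Qed.

Lemma char_poly_block_diag n m (M : 'M[K]_n) (N : 'M[K]_m) :
  char_poly (block_mx M 0 0 N) = char_poly M * char_poly N.
Proof. by rewrite /char_poly char_block_diag_mx det_ublock. Qed.

Lemma char_poly_diag n (M : 'M[K]_n) : is_diag_mx M ->
  char_poly M = \prod_(z <- [seq M i i | i <- enum 'I_n]) ('X - z%:P).
Proof.
by move=> /is_diag_mx_is_trig /char_poly_trig ->; rewrite big_map big_enum.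
Qed.

End CharPoly.

(** * Normality and unitary conjugation *)

Section Normal.
Variable C : numClosedFieldType.

Lemma trmxC_mul m n p (M : 'M[C]_(m, n)) (N : 'M[C]_(n, p)) :
  (M *m N)^t* = N^t* *m M^t*.
Proof. by rewrite trmx_mul map_mxM. Qed.

Lemma block_mx_trC m n (M : 'M[C]_m) (N : 'M[C]_(m, n)) (P : 'M[C]_(n, m)) Q :
  (block_mx M N P Q)^t* = block_mx (M^t*) (P^t*) (N^t*) (Q^t*).
Proof. by rewrite tr_block_mx map_block_mx. Qed.

Lemma unitarymxC n (U : 'M[C]_n) : U \is unitarymx -> U^t* *m U = 1%:M.
Proof. by move=> /unitarymxP/mulmx1C. Qed.

Lemma normalmx_castmx n m (e : n = m) (M : 'M[C]_n) :
  (castmx (e, e) M \is normalmx) = (M \is normalmx).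
Proof. by case: m / e; rewrite castmx_id. Qed.

(** One implication suffices: conjugating by [U^t*], again unitary, undoes the conjugation by
    [U]. *)
Lemma normalmx_conj n (U M : 'M[C]_n) : U \is unitarymx ->
  (U^t* *m M *m U \is normalmx) = (M \is normalmx).
Proof.
suff hom (V N : 'M[C]_n) : V \is unitarymx -> N \is normalmx ->
    V^t* *m N *m V \is normalmx.
  move=> uU; apply/idP/idP; last exact: hom.
  move/(@hom (U^t*)); rewrite trmxC_unitary trmxCK => /(_ uU).
  rewrite !mulmxA (unitarymxP uU) mul1mx -mulmxA (unitarymxP uU).
  by rewrite mulmx1.
move=> uV /normalmxP nN; apply/normalmxP.
rewrite !trmxC_mul trmxCK !mulmxA.
rewrite -[_ *m V *m _]mulmxA (unitarymxP uV) mulmx1.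
rewrite -[_ *m V *m V^t*]mulmxA (unitarymxP uV) mulmx1.
by rewrite -!mulmxA [N *m _]mulmxA nN !mulmxA.
Qed.

Lemma normalmx_block_diag n m (M : 'M[C]_n) (N : 'M[C]_m) :
  M \is normalmx -> N \is normalmx -> block_mx M 0 0 N \is normalmx.
Proof.
move=> /normalmxP nM /normalmxP nN; apply/normalmxP.
rewrite block_mx_trC !mulmx_block !trmx0 !map_mx0.
by rewrite !mul0mx !mulmx0 !addr0 !add0r nM nN.
Qed.

Lemma normalmx_diag n (M : 'M[C]_n) : is_diag_mx M -> M \is normalmx.
Proof.
move=> /diag_mxP[d ->]; apply/normalmxP.
by rewrite tr_diag_mx map_diag_mx; exact: diag_mxC.
Qed.

(** The adjoint is again affine in H, because H is Hermitian, and affine expressions in one matrix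
    commute. *)
Lemma normalmx_affine n (a b : C) (H : 'M[C]_n) :
  H^t* = H -> a *: H + b%:M \is normalmx.
Proof.
move=> hH; apply/normalmxP.
rewrite linearD linearZ /= map_mxD map_mxZ hH tr_scalar_mx map_scalar_mx.
have comm_affine c e M : comm_mx M H -> comm_mx M (c *: H + e%:M).
  move=> MH; apply: comm_mxD (comm_mx_scalar _ _).
  by rewrite -mul_scalar_mx; apply: comm_mxM MH; exact: comm_mx_scalar.
exact/comm_affine/comm_mx_sym/comm_affine/comm_mx_refl.
Qed.

Lemma block1_unitary n (U : 'M[C]_n) : U \is unitarymx ->
  block_mx U 0 0 1%:M \is @unitarymx C (n + 1) (n + 1).
Proof.
move=> /unitarymxP uU; apply/unitarymxP.
rewrite block_mx_trC mulmx_block !trmx0 !map_mx0 trmx1 map_mx1.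
by rewrite !mul0mx !mulmx0 mulmx1 !addr0 add0r uU -scalar_mx_block.
Qed.

Lemma block1_conj n (U A : 'M[C]_n) (v : 'cV_n) (w : 'rV_n) (y : 'M_1) :
  let U1 := block_mx U 0 0 1%:M : 'M_(n + 1) in
  U1^t* *m block_mx A v w y *m U1 =
  block_mx (U^t* *m A *m U) (U^t* *m v) (w *m U) y.
Proof.
rewrite /= block_mx_trC !trmx0 !map_mx0 trmx1 map_mx1 !mulmx_block.
by rewrite !mul0mx !mulmx0 !mulmx1 !mul1mx !addr0 !add0r.
Qed.

End Normal.

(** * Unitary diagonalization in a prescribed order *)

Section Diagonalization.
Variable R : realType.

Lemma perm_eigenvals n (A : 'M[R[i]]_n) (t : seq R[i]) :
  char_poly A = \prod_(z <- t) ('X - z%:P) -> perm_eq (eigenvals A) t.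
Proof. by rewrite eigenvalsE; exact: prod_XsubC_eq. Qed.

Lemma perm_eigenvals_diag n (A : 'M[R[i]]_n) : is_diag_mx A ->
  perm_eq (eigenvals A) [seq A i i | i <- enum 'I_n].
Proof. by move=> dA; apply: perm_eigenvals; exact: char_poly_diag. Qed.

Lemma perm_eigenvals_block_diag n m (A : 'M[R[i]]_n) (B : 'M[R[i]]_m) :
  perm_eq (eigenvals (block_mx A 0 0 B)) (eigenvals A ++ eigenvals B).
Proof.
by apply: perm_eigenvals; rewrite char_poly_block_diag !eigenvalsE big_cat.
Qed.

Lemma eq_eigenvals n m (A : 'M[R[i]]_n) (B : 'M[R[i]]_m) :
  char_poly A = char_poly B -> perm_eq (eigenvals A) (eigenvals B).
Proof. by move=> AB; apply: perm_eigenvals; rewrite AB eigenvalsE. Qed.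

(** The order [t] of the diagonal is free, which later allows the eigenvalues on the line to be put
    last. The spectral theorem fixes some order; permuting the columns of the unitary produces any
    other. *)
Lemma normalmx_diagonalize n (A : 'M[R[i]]_n) (t : seq R[i]) :
  A \is normalmx -> perm_eq (eigenvals A) t ->
  exists2 U : 'M[R[i]]_n, U \is unitarymx &
    U^t* *m A *m U = diag_mx (\row_i t`_i).
Proof.
move=> /orthomx_spectralP; set P := spectralmx A; set d := spectral_diag A.
have uP : P \is unitarymx := spectral_unitarymx A.
rewrite invmx_unitary // => defA tA.
pose u := [tuple d 0 i | i < n].
(* Both lists consist of the roots of the characteristic polynomial, so a permutation [s] relates
   them. *)
have /tuple_permP[s def_t] : perm_eq t u.
  rewrite -(permPl tA); apply: perm_eigenvals.
  rewrite defA char_poly_conj ?(unitarymxP uP) // char_poly_diag.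
    congr bigop.body; rewrite /u /=; apply: eq_map => i.
    by rewrite mxE eqxx.
  exact: diag_mx_is_diag.
have rsP : (colsub s (P^t*))^t* = rowsub s P.
  by apply/matrixP => i j; rewrite !mxE conjCK.
exists (colsub s (P^t*)).
  apply/unitarymxP/mulmx1C; rewrite rsP mulmx_colsub mul_rowsub_mx.
  rewrite (unitarymxP uP); apply/matrixP => i j.
  by rewrite !mxE inj_eq //; exact: perm_inj.
rewrite rsP -!mulmxA mulmx_colsub defA -!mulmxA (unitarymxP uP) mulmx1.
rewrite mulmx_colsub mul_rowsub_mx mulmxA (unitarymxP uP) mul1mx.
apply/matrixP => i j; rewrite !mxE inj_eq; last exact: perm_inj.
by rewrite def_t -tnth_nth !tnth_mktuple.
Qed.

Lemma hermitian_diagonalize n (H : 'M[R[i]]_n) : H^t* = H ->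
  exists (U : 'M[R[i]]_n) (d : seq R), [/\ U \is unitarymx,
    U^t* *m H *m U = diag_mx (\row_i (d`_i)%:C),
    sorted <=%R d & perm_eq (eigenvals H) [seq x%:C | x <- d]].
Proof.
move=> hH.
have nH : H \is normalmx by apply/normalmxP; rewrite hH.
pose d := sort <=%R [seq complex.Re z | z <- eigenvals H].
have Hd : perm_eq (eigenvals H) [seq x%:C | x <- d].
  (* A first diagonalization exhibits each eigenvalue as a diagonal entry of a Hermitian matrix,
     hence real; passing to real parts in [d] loses nothing. *)
  have [V uV dV] := normalmx_diagonalize nH (perm_refl _).
  rewrite perm_sym (perm_trans (perm_map _ (permEl (perm_sort _ _)))) //.
  rewrite -map_comp map_id_in // => z /(nthP 0)[k].
  rewrite size_eigenvals => lt_kn <- /=; apply: RRe_real; apply/CrealP.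
  pose j := Ordinal lt_kn.
  have: (V^t* *m H *m V)^t* = V^t* *m H *m V.
    by rewrite !trmxC_mul trmxCK hH mulmxA.
  by rewrite dV => /matrixP/(_ j j); rewrite !mxE eqxx.
(* The second diagonalization uses the sorted order. *)
have [U uU dU] := normalmx_diagonalize nH Hd.
exists U, d; split=> //; last exact: sort_sorted le_total _.
rewrite dU; congr diag_mx; apply/rowP => i; rewrite !mxE (nth_map 0) //.
by rewrite -(size_map (real_complex R)) -(perm_size Hd) size_eigenvals.
Qed.

End Diagonalization.

(** * Cauchy interlacing by compressions *)

Section Interlacing.

Lemma card_ord_lt n m : (m <= n)%N -> #|[pred i : 'I_n | (i < m)%N]| = m.
Proof.
move=> le_mn; rewrite -sum1_card -(big_ord_widen _ (fun=> 1%N)) //.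
by rewrite sum1_card card_ord.
Qed.

Lemma card_ord_ge n m : (m <= n)%N ->
  #|[pred i : 'I_n | (m <= i)%N]| = (n - m)%N.
Proof.
move=> le_mn; apply: (@addnI m); rewrite subnKC // -[RHS](card_ord n).
rewrite -(cardC [pred i : 'I_n | (i < m)%N]) card_ord_lt //.
by congr addn; apply: eq_card => i; rewrite !inE -leqNgt.
Qed.

(** The submatrix of G with rows in [P] and columns in [Q] has more rows than columns, so its left
    kernel is nonzero; a kernel vector is extended by zero outside [P]. *)
Lemma supported_kernel (K : fieldType) p q (G : 'M[K]_(p, q))
    (P : pred 'I_p) (Q : pred 'I_q) : (#|Q| < #|P|)%N ->
  exists y : 'rV_p, [/\ y != 0, forall i, ~~ P i -> y 0 i = 0
                      & forall k, Q k -> (y *m G) 0 k = 0].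
Proof.
move=> ltQP.
pose f (a : 'I_#|P|) := enum_val a; pose g (b : 'I_#|Q|) := enum_val b.
have /rowV0Pn[u /sub_kermxP uM u_neq0] : kermx (mxsub f g G) != 0.
  rewrite kermx_eq0; apply: contraL ltQP => /eqP {1}<-.
  by rewrite -leqNgt rank_leq_col.
(* The product [u *m rowsub f 1%:M] is this extension by zero. *)
have yE i a : f a = i -> (u *m rowsub f 1%:M) 0 i = u 0 a.
  move=> <-; rewrite mxE (bigD1 a) //= big1 => [|b neq_ba].
    by rewrite !mxE eqxx mulr1 addr0.
  by rewrite !mxE (inj_eq enum_val_inj) (negPf neq_ba) mulr0.
exists (u *m rowsub f 1%:M); split.
- apply: contraNneq u_neq0 => y0; apply/eqP/rowP => a.
  by rewrite -(yE _ _ erefl) y0 !mxE.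
- move=> i Pi; rewrite mxE big1 // => a _; rewrite !mxE.
  case: eqP => [fa|]; last by rewrite mulr0.
  by have: P (f a) := enum_valP a; rewrite fa (negPf Pi).
move=> k Qk; have kQ : k \in Q by [].
transitivity ((u *m mxsub f g G) 0 (enum_rank_in kQ k)); last by rewrite uM mxE.
rewrite -mulmxA mul_rowsub_mx mul1mx !mxE; apply: eq_bigr => a _.
by rewrite !mxE /g enum_rankK_in.
Qed.

Variable R : realType.

Lemma quad_diag n (d : 'I_n -> R) (x : 'rV[R[i]]_n) :
  (x *m diag_mx (\row_i (d i)%:C) *m x^t*) 0 0 =
  \sum_i (d i)%:C * `|x 0 i| ^+ 2.
Proof.
rewrite mxE; apply: eq_bigr => k _.
rewrite mul_mx_diag !mxE normCK; ring.
Qed.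

(* By dimension count some [y != 0] is supported on [P] with [y *m G] vanishing
   on [Q]; as [G] is isometric, the form of [y] is at most [s |y|^2] and at
   least [t |y|^2]. *)
Lemma compression_le p q (G : 'M[R[i]]_(p, q)) (a : 'I_p -> R) (b : 'I_q -> R)
    (P : pred 'I_p) (Q : pred 'I_q) (s t : R) :
  G \is unitarymx ->
  G *m diag_mx (\row_k (b k)%:C) *m G^t* = diag_mx (\row_i (a i)%:C) ->
  (#|Q| < #|P|)%N ->
  (forall i, P i -> a i <= s) -> (forall k, ~~ Q k -> t <= b k) -> t <= s.
Proof.
move=> uG defa ltQP aP bQ.
have [y [y_neq0 yP yQ]] := supported_kernel G ltQP.
pose N := \sum_i `|y 0 i| ^+ 2.
have N_gt0 : 0 < N.
  have ge0 i : true -> 0 <= `|y 0 i| ^+ 2 by rewrite exprn_ge0.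
  rewrite lt_neqAle sumr_ge0 // andbT eq_sym psumr_neq0 //.
  have /rV0Pn[k yk] := y_neq0; apply/hasP; exists k; rewrite ?mem_index_enum //.
  by rewrite /= exprn_gt0 // normr_gt0.
have NE : N = \sum_k `|(y *m G) 0 k| ^+ 2.
  transitivity ((y *m y^t*) 0 0).
    by rewrite mxE; apply: eq_bigr => k _; rewrite !mxE normCK.
  rewrite -[y in y *m _](mulmxtVK _ uG) -[_ *m y^t*]mulmxA -trmxC_mul mxE.
  by apply: eq_bigr => k _; rewrite !mxE normCK.
have : t%:C * N <= s%:C * N; last by rewrite ler_pM2r // lecR.
apply: (@le_trans _ _ (\sum_k (b k)%:C * `|(y *m G) 0 k| ^+ 2)).
  rewrite NE mulr_sumr; apply: ler_sum => k _.
  have [Qk|Qk] := boolP (Q k); first by rewrite yQ // normr0 expr0n !mulr0.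
  by rewrite ler_wpM2r ?exprn_ge0 // lecR bQ.
have -> : \sum_k (b k)%:C * `|(y *m G) 0 k| ^+ 2 =
    \sum_i (a i)%:C * `|y 0 i| ^+ 2.
  by rewrite -!quad_diag -defa trmxC_mul !mulmxA.
rewrite mulr_sumr; apply: ler_sum => k _.
have [Pk|Pk] := boolP (P k); last by rewrite yP // normr0 expr0n !mulr0.
by rewrite ler_wpM2r ?exprn_ge0 // lecR aP.
Qed.

(** Negating both spectra reverses every inequality and reduces this to [compression_le]. *)
Lemma compression_ge p q (G : 'M[R[i]]_(p, q)) (a : 'I_p -> R) (b : 'I_q -> R)
    (P : pred 'I_p) (Q : pred 'I_q) (s t : R) :
  G \is unitarymx ->
  G *m diag_mx (\row_k (b k)%:C) *m G^t* = diag_mx (\row_i (a i)%:C) ->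
  (#|Q| < #|P|)%N ->
  (forall i, P i -> s <= a i) -> (forall k, ~~ Q k -> b k <= t) -> s <= t.
Proof.
move=> uG defa ltQP aP bQ; rewrite -lerN2.
apply: (@compression_le _ _ G (\- a) (\- b) _ _ _ _ uG _ ltQP).
- have oppd m (d : 'I_m -> R) : diag_mx (\row_i ((\- d) i)%:C) =
      - diag_mx (\row_i (d i)%:C).
    by rewrite -raddfN; congr diag_mx; apply/rowP => k; rewrite !mxE rmorphN.
  by rewrite !oppd mulmxN mulNmx defa.
- by move=> i Pi; rewrite /= lerN2 aP.
- by move=> k Qk; rewrite /= lerN2 bQ.
Qed.

(** With [E] the truncation to the first p coordinates, [V^t* *m E *m U] is an isometric compression
    taking the diagonalized H to its diagonalized leading block. The two bounds then follow by
    counting indices. *)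
Lemma cauchy_interlacing p (H : 'M[R[i]]_(p + 1)) : H^t* = H ->
  exists a b : seq R,
    [/\ perm_eq (eigenvals (ulsubmx H)) [seq x%:C | x <- a],
        perm_eq (eigenvals H) [seq x%:C | x <- b], sorted <=%R a
      & forall j, (j < p)%N -> b`_j <= a`_j <= b`_j.+1].
Proof.
move=> hH; have hK : (ulsubmx H)^t* = ulsubmx H.
  by rewrite -{2}hH; apply/matrixP => i j; rewrite !mxE.
have [U [b [uU dU sb pb]]] := hermitian_diagonalize hH.
have [V [a [uV dV sa pa]]] := hermitian_diagonalize hK.
have size_a : size a = p.
  by rewrite -(size_map (real_complex R)) -(perm_size pa) size_eigenvals.
have size_b : size b = p.+1.
  by rewrite -(size_map (real_complex R)) -(perm_size pb) size_eigenvals addn1.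
exists a, b; split=> // j lt_jp.
pose E : 'M[R[i]]_(p, p + 1) := row_mx 1%:M 0.
have Et : E^t* = col_mx 1%:M 0.
  by rewrite tr_row_mx map_col_mx trmx1 map_mx1 trmx0 map_mx0.
have EHE : E *m H *m E^t* = ulsubmx H.
  rewrite -[H]submxK Et mul_row_block mul_row_col block_mxKul.
  by rewrite !mul1mx !mul0mx mulmx0 mulmx1 !addr0.
have uE : E \is unitarymx.
  by apply/unitarymxP; rewrite Et mul_row_col mulmx1 mulmx0 addr0.
have uG : V^t* *m E *m U \is unitarymx.
  apply: (mul_unitarymx _ uU); apply: (mul_unitarymx _ uE).
  by rewrite trmxC_unitary; exact: uV.
have defa : V^t* *m E *m U *m diag_mx (\row_i (b`_i)%:C) *m
    (V^t* *m E *m U)^t* = diag_mx (\row_i (a`_i)%:C).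
  rewrite -dU -dV -EHE !trmxC_mul trmxCK !mulmxA.
  by rewrite !(mulmxtVK _ uU).
have la i k : (i <= k)%N -> (k < p)%N -> a`_i <= a`_k.
  move=> le_ik lt_kp; apply: (le_sorted_leq_nth 0 sa); rewrite ?inE ?size_a //.
  exact: leq_ltn_trans lt_kp.
have lb i k : (i <= k)%N -> (k < p.+1)%N -> b`_i <= b`_k.
  move=> le_ik lt_kp; apply: (le_sorted_leq_nth 0 sb); rewrite ?inE ?size_b //.
  exact: leq_ltn_trans lt_kp.
apply/andP; split.
- apply: (compression_le (a := fun i : 'I_p => a`_i)
    (b := fun k : 'I_(p + 1) => b`_k) (P := [pred i : 'I_p | (i < j.+1)%N])
    (Q := [pred k : 'I_(p + 1) | (k < j)%N]) uG defa).
  + by rewrite !card_ord_lt // addn1 ltnW // ltnW.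
  + by move=> i; rewrite /= ltnS => le_ij; apply: la.
  + move=> k; rewrite /= -leqNgt => le_jk.
    by apply: lb => //; rewrite -[p.+1]addn1.
- apply: (compression_ge (a := fun i : 'I_p => a`_i)
    (b := fun k : 'I_(p + 1) => b`_k) (P := [pred i : 'I_p | (j <= i)%N])
    (Q := [pred k : 'I_(p + 1) | (j.+2 <= k)%N]) uG defa).
  + by rewrite !card_ord_ge ?(ltnW lt_jp) ?addn1 ?ltnS // subSS ltn_sub2l.
  + by move=> i /= le_ji; apply: la.
  + by move=> k /=; rewrite -ltnNge ltnS => le_kj; apply: lb.
Qed.

End Interlacing.

(** * Square roots in [TU], points on the line, equal outer products *)

Section Line.
Variable R : realType.

(** The argument is acos a: it is below pi because a is not -1, and its sine, the nonnegative root
    of 1 - a^2, is b. *)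
Lemma TU_upper (a b : R) : a ^+ 2 + b ^+ 2 = 1 -> 0 <= b -> a != -1 ->
  TU (a +i* b).
Proof.
move=> ab1 b_ge0 aN1.
have norm1 : `|a +i* b| = 1 by rewrite normc_def /= ab1 sqrtr1.
have a2 : a ^+ 2 <= 1 by rewrite -ab1 lerDl sqr_ge0.
have a_itv : -1 <= a <= 1.
  by rewrite -ler_norml -(expr_le1 (n := 2)) // real_normK ?num_real.
split=> //; exists (acos a).
  rewrite acos_ge0 // acos_ltpi //; have /andP[a_ge a_le] := a_itv.
  by rewrite lt_neqAle eq_sym aN1 a_ge a_le.
rewrite norm1 mul1r acosK ?in_itv // sin_acos // -ab1 addrAC subrr add0r.
by rewrite sqrtr_sqr ger0_norm.
Qed.

(** Exactly one of two opposite unit numbers lies on the half-open upper arc, so a square root is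
    negated when it is below the real axis or equal to -1. *)
Lemma TU_sqrt (c : R[i]) : `|c| = 1 ->
  exists2 theta : R[i], TU theta & theta ^+ 2 = c.
Proof.
move=> c1; case Es: (sqrtC c) => [a b].
have sqrt_c : (a +i* b) ^+ 2 = c by rewrite -Es sqrtCK.
have ab1 : a ^+ 2 + b ^+ 2 = 1.
  apply: complexI; rewrite (add_Re2_Im2 (a +i* b)) -normrX sqrt_c c1.
  by rewrite rmorph1.
have [b_lt0|b_ge0] := ltP b 0.
  exists (- (a +i* b)); last by rewrite sqrrN.
  apply: TU_upper; rewrite ?sqrrN ?oppr_ge0 1?ltW //.
  rewrite eqr_opp; apply: contraTneq b_lt0 => a1; move/eqP: ab1.
  rewrite a1 expr1n -subr_eq0 addrAC subrr add0r sqrf_eq0 => /eqP ->.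
  by rewrite ltxx.
have [aN1|aN1] := eqVneq a (-1); last first.
  by exists (a +i* b) => //; exact: TU_upper.
have b0 : b = 0.
  move/eqP: ab1; rewrite aN1 sqrrN expr1n -subr_eq0 addrAC subrr add0r sqrf_eq0.
  by move/eqP.
exists (- (a +i* b)); last by rewrite sqrrN.
apply: TU_upper; rewrite ?sqrrN //; first by rewrite b0 oppr0.
by rewrite aN1 opprK -subr_eq0 opprK -(natrD _ 1 1) pnatr_eq0.
Qed.

Lemma TU_conj (theta : R[i]) : TU theta -> theta * theta^* = 1.
Proof. by case=> th1 _; rewrite -normCK th1 expr1n. Qed.

(** As [theta^*] inverts [theta], the only candidate for the parameter rho is (z - y) [theta^*]. *)
Lemma mem_line (y theta z : R[i]) : theta * theta^* = 1 ->
  (z \in line y theta) = ((z - y) * theta^* \is Num.real).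
Proof.
move=> th1; apply/idP/idP.
  rewrite in_setE => -[rho ->]; rewrite addrAC subrr add0r -mulrA th1 mulr1.
  by apply/complex_realP; exists rho.
move/complex_realP=> [rho def_rho]; rewrite in_setE; exists rho.
by rewrite -def_rho mulrAC -mulrA th1 mulr1 addrC subrK.
Qed.

(** Diagonal entries give |v_k| = |w_k|; a column k with v_k nonzero gives v as a multiple of w,
    with factor the conjugate of w_k / v_k. *)
Lemma outer_eq (C : numClosedFieldType) n (v w : 'cV[C]_n) :
  v *m v^t* = w *m w^t* ->
  exists2 c : C, `|c| = 1 & v = c *: w.
Proof.
move=> /matrixP vw.
have {}vw k j : v k 0 * (v j 0)^* = w k 0 * (w j 0)^*.
  by have := vw k j; rewrite !mxE !big_ord1 !mxE.
have norm_vw k : `|v k 0| = `|w k 0|.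
  by apply/eqP; rewrite -(eqrXn2 (n := 2)) // !normCK vw.
have [v0|/cV0Pn[k vk]] := eqVneq v 0.
  exists 1; rewrite ?normr1 // scale1r v0; apply/colP => k; apply/esym/eqP.
  by rewrite mxE -normr_eq0 -norm_vw v0 mxE normr0.
exists ((w k 0)^* / (v k 0)^*).
  by rewrite normf_div !norm_conjC norm_vw divff // -norm_vw normr_eq0.
apply/colP => j; rewrite mxE mulrAC [_^* * w j 0]mulrC -vw mulfK //.
by rewrite conjC_eq0.
Qed.

End Line.

(** * The arrow matrix: splitting, normality, spectrum *)

Section Arrow.
Variable R : realType.

Lemma map_enum_nth (T T' : Type) (x0 : T) (f : T -> T') s n : size s = n ->
  [seq f (nth x0 s i) | i : 'I_n <- enum 'I_n] = [seq f z | z <- s].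
Proof.
move=> <-; rewrite -[in RHS](mkseq_nth x0 s) /mkseq -val_enum_ord -!map_comp.
exact: eq_map.
Qed.

(** The corner is 0 because y enters only through the scalar matrix added to
    [theta *: border D r]. *)
Definition border p (D : 'M[R]_p) (r : 'cV[R[i]]_p) : 'M[R[i]]_(p + 1) :=
  block_mx (map_mx (real_complex R) D) r (r^t*) 0.

Lemma diag_real_trC p (D : 'M[R]_p) : is_diag_mx D ->
  (map_mx (real_complex R) D)^t* = map_mx (real_complex R) D.
Proof.
move=> /diag_mxP[d ->]; apply/matrixP => i j; rewrite !mxE [j == i]eq_sym.
transitivity ((d 0 i *+ (i == j))%:C); last by [].
by case: eqP => [->|_]; apply/CrealP/complex_realP; eexists.
Qed.

Lemma border_trC p (D : 'M[R]_p) (r : 'cV[R[i]]_p) : is_diag_mx D ->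
  (border D r)^t* = border D r.
Proof.
move=> dD; rewrite /border block_mx_trC diag_real_trC // trmxCK.
by rewrite trmx0 map_mx0.
Qed.

(** Regrouping m + p + 1 as m + (p + 1) exposes a direct sum, so normality and spectrum can be read
    off block by block. *)
Lemma arrow_block m p (y theta : R[i]) (B : 'M[R[i]]_m) (D : 'M[R]_p)
    (r : 'cV[R[i]]_p) :
  castmx (esym (addnA m p 1), esym (addnA m p 1)) (arrow y theta B D r) =
  block_mx B 0 0 (theta *: border D r + y%:M).
Proof.
rewrite /arrow -block_mxA row_mx0 col_mx0; congr (block_mx _ _ _ _).
rewrite /border scale_block_mx scaler0 scalar_mx_block add_block_mx.
by rewrite !addr0 add0r.
Qed.

Lemma arrow_normalmx m p (y theta : R[i]) (B : 'M[R[i]]_m) (D : 'M[R]_p)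
    (r : 'cV[R[i]]_p) :
  is_diag_mx B -> is_diag_mx D -> arrow y theta B D r \is normalmx.
Proof.
move=> dB dD; rewrite -(normalmx_castmx (esym (addnA m p 1))) arrow_block.
apply: normalmx_block_diag; first exact: normalmx_diag.
exact/normalmx_affine/border_trC.
Qed.

Lemma eigenvals_arrow m p (y theta : R[i]) (B : 'M[R[i]]_m) (D : 'M[R]_p)
    (r : 'cV[R[i]]_p) :
  perm_eq (eigenvals (arrow y theta B D r))
    (eigenvals B ++ eigenvals (theta *: border D r + y%:M)).
Proof.
rewrite -(permPr (perm_eigenvals_block_diag _ _)) -arrow_block.
by apply: eq_eigenvals; rewrite char_poly_castmx.
Qed.

(** A unitary that diagonalizes A also diagonalizes a A + b. *)
Lemma eigenvals_affine n (a b : R[i]) (A : 'M[R[i]]_n) : A \is normalmx ->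
  perm_eq (eigenvals (a *: A + b%:M)) [seq b + a * z | z <- eigenvals A].
Proof.
move=> nA; have [U uU dU] := normalmx_diagonalize nA (perm_refl _).
have dUab : U^t* *m (a *: A + b%:M) *m U =
    diag_mx (\row_i (b + a * (eigenvals A)`_i)).
  rewrite mulmxDr mulmxDl -scalemxAr -scalemxAl dU scalar_mxC -mulmxA.
  rewrite unitarymxC // mulmx1; apply/matrixP => i j; rewrite !mxE.
  by case: eqP => _; rewrite ?mulr1n ?mulr0n ?mulr0 ?addr0 // addrC.
apply: perm_eigenvals.
rewrite -(char_poly_conj _ (unitarymxP uU)) dUab.
rewrite char_poly_diag ?diag_mx_is_diag //.
rewrite -(map_enum_nth 0 _ (size_eigenvals A)); congr bigop.body.
by apply: eq_map => k; rewrite !mxE eqxx.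
Qed.

Lemma border_ulsubmx p (D : 'M[R]_p) (r : 'cV[R[i]]_p) :
  ulsubmx (border D r) = map_mx (real_complex R) D.
Proof. exact: block_mxKul. Qed.

Lemma eigenvals_Lambda_line p (y theta : R[i]) (D : 'M[R]_p) :
  is_diag_mx D -> all (mem (line y theta)) (eigenvals (Lambda y theta D)).
Proof.
move=> /diag_mxP[d ->].
have dL : is_diag_mx (Lambda y theta (diag_mx d)).
  apply/is_diag_mxP => i j neq_ij; rewrite !mxE.
  have /negPf neq_ij' : i != j by [].
  by rewrite neq_ij' mulr0n rmorph0 mulr0 add0r mulr0n.
rewrite (perm_all _ (perm_eigenvals_diag dL)); apply/allP => z /mapP[k _ ->].
rewrite /= in_setE; exists (d 0 k).
by rewrite !mxE eqxx addrC [theta * _]mulrC.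
Qed.

(** Off-line entries come first, so [B] is the leading part of d and [r] the trailing part of x. The
    size n is tied to m + p by an equation, so that destructing [e] removes the casts. *)
Lemma arrow_diag m p n (e : (m + p = n)%N) (e' : (m + p + 1 = n + 1)%N)
    (d : 'rV[R[i]]_n) (x : 'cV[R[i]]_n) (y theta : R[i]) :
  theta * theta^* = 1 ->
  (forall k : 'I_n, (d 0 k \in line y theta) = (m <= k)%N) ->
  (forall k, d 0 k \notin line y theta -> x k 0 = 0) ->
  exists (B : 'M[R[i]]_m) (D : 'M[R]_p) (r : 'cV[R[i]]_p),
  [/\ is_diag_mx B, all [predC line y theta] (eigenvals B), is_diag_mx D,
      castmx (e, e) (block_mx B 0 0 (Lambda y theta D)) = diag_mx d
    & castmx (e', e') (arrow y theta B D r) =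
      block_mx (diag_mx d) (theta *: x) (theta *: x^t*) y%:M].
Proof.
case: n / e e' d x => e' d x th1 dP xP.
pose B := diag_mx (lsubmx d).
(* These are the quotients (d_k - y) / [theta], real because the trailing entries lie on the
   line. *)
pose D := diag_mx (\row_k complex.Re ((d 0 (rshift m k) - y) * theta^*)).
have dE : block_mx B 0 0 (Lambda y theta D) = diag_mx d.
  rewrite -[in RHS](hsubmxK d) diag_mx_row; congr block_mx.
  apply/matrixP => i j; rewrite !mxE; case: eqP => [->|_]; last first.
    by rewrite !mulr0n rmorph0 mulr0 add0r.
  rewrite !mulr1n RRe_real; last by rewrite -mem_line // dP /= leq_addr.
  by rewrite mulrCA th1 mulr1 subrK.
have xE : x = col_mx 0 (dsubmx x).
  rewrite -[LHS]vsubmxK; congr col_mx; apply/colP => k; rewrite !mxE.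
  by apply: xP; rewrite dP /= -ltnNge.
exists B, D, (dsubmx x); split; rewrite ?diag_mx_is_diag ?castmx_id //.
- rewrite (perm_all _ (perm_eigenvals_diag (diag_mx_is_diag _))).
  apply/allP => z /mapP[k _ ->].
  by rewrite !mxE eqxx mulr1n /= dP /= -ltnNge.
rewrite /arrow dE.
rewrite [in RHS]xE scale_col_mx scaler0 tr_col_mx map_row_mx trmx0 map_mx0.
by rewrite scale_row_mx scaler0.
Qed.

(** Comparing upper-left blocks extracts a diagonalization of A itself, from which the spectrum of A
    is read. *)
Lemma bordered_castmx m p n (e : (m + p = n)%N) (e' : (m + p + 1 = n + 1)%N)
    (U A : 'M[R[i]]_n) (v w : 'cV[R[i]]_n) (y theta : R[i])
    (B : 'M[R[i]]_m) (D : 'M[R]_p) (r : 'cV[R[i]]_p) :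
  let U1 := block_mx U 0 0 1%:M : 'M_(n + 1) in
  U1^t* *m bordered A v w y *m U1 = castmx (e', e') (arrow y theta B D r) ->
  U^t* *m A *m U = castmx (e, e) (block_mx B 0 0 (Lambda y theta D)).
Proof.
rewrite /= block1_conj.
case: n / e e' U A v w => e' U A v w.
by rewrite !castmx_id => /eq_block_mx[].
Qed.

(** Row k of the upper-right block of the normality equation says that (d_k - y) [theta^*] and its
    conjugate agree after multiplication by x_k. *)
Lemma bordered_normal_offline n (d : 'rV[R[i]]_n) (x : 'cV[R[i]]_n)
    (y theta : R[i]) :
  theta * theta^* = 1 ->
  block_mx (diag_mx d) (theta *: x) (theta *: x^t*) y%:M
    \is @normalmx _ (n + 1) ->
  forall k, d 0 k \notin line y theta -> x k 0 = 0.
Proof.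
move=> th1 /normalmxP; rewrite block_mx_trC !mulmx_block.
move=> /eq_block_mx[_ + _ _] k; move=> /matrixP/(_ k 0).
rewrite tr_diag_mx map_diag_mx mul_mx_scalar tr_scalar_mx map_scalar_mx.
rewrite !mul_mx_scalar !mul_diag_mx !mxE !rmorphM /= conjCK => eq_k.
rewrite mem_line // CrealE !rmorphM /= conjCK rmorphB /= => neq_k.
apply/eqP; apply: contraNT neq_k => xk; rewrite -(inj_eq (mulfI xk)).
(* Zero is rewritten as the difference of the two sides of [eq_k]. *)
rewrite -subr_eq0 -(subrr (d 0 k * (theta^* * x k 0) + y^* * (theta * x k 0))).
rewrite {1}eq_k; apply/eqP; ring.
Qed.

End Arrow.

(** * From normality to the normal form and back *)

Section NormalForm.
Variable R : realType.

Lemma unitary_diag_eigenvector n (A U : 'M[R[i]]_n) (d : 'rV_n) (j : 'I_n) :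
  U \is unitarymx -> U^t* *m A *m U = diag_mx d -> is_eigenvector A (col j U).
Proof.
move=> uU dU; split.
  apply/eqP => /colP U0; have /matrixP/(_ j j) := unitarymxC uU.
  rewrite !mxE eqxx big1 => [/esym/eqP|k _]; first by rewrite oner_eq0.
  by have := U0 k; rewrite !mxE => ->; rewrite mulr0.
exists (d 0 j).
have AU : A *m U = U *m diag_mx d.
  by rewrite -dU !mulmxA (unitarymxP uU) mul1mx.
apply/colP => k; have /matrixP/(_ k j) := AU.
rewrite mul_mx_diag !mxE mulrC => <-.
by apply: eq_bigr => l _; rewrite mxE.
Qed.

(** The upper-left blocks of the two products are A A* + v v* and A* A + w w*; normality of A
    cancels the first terms. *)
Lemma bordered_normal_rank1 n (A : 'M[R[i]]_n) (v w : 'cV[R[i]]_n) (y : R[i]) :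
  A \is normalmx -> bordered A v w y \is normalmx -> v *m v^t* = w *m w^t*.
Proof.
move=> /normalmxP nA /normalmxP.
rewrite /bordered block_mx_trC !mulmx_block trmxCK => /eq_block_mx[+ _ _ _].
by rewrite nA => /addrI.
Qed.

Lemma bordered_normal_form n (A : 'M[R[i]]_n) (v w : 'cV[R[i]]_n) (y : R[i]) :
  A \is normalmx -> bordered A v w y \is normalmx ->
  exists theta : R[i], TU theta /\
    exists (U : 'M[R[i]]_n)
           (B : 'M[R[i]]_(n - nb_line A y theta))
           (D : 'M[R]_(nb_line A y theta))
           (r : 'cV[R[i]]_(nb_line A y theta)), normal_form v w U B D r.
Proof.
move=> nA nM; have [c c1 vcw] := outer_eq (bordered_normal_rank1 nA nM).
have [theta thTU th2] := TU_sqrt c1; exists theta; split=> //.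
have th1 := TU_conj thTU.
pose x := theta^* *: v.
have vE : v = theta *: x by rewrite scalerA th1 scale1r.
(* From v = [theta]^2 w one gets x = [theta] w. *)
have wE : w^t* = theta *: x^t*.
  rewrite /x vcw -th2 scalerA expr2 mulrA [theta^* * _]mulrC th1 mul1r.
  by rewrite linearZ /= map_mxZ scalerA th1 scale1r.
pose on := [pred z | z \in line y theta].
(* The eigenvalues off the line come first, those on it last, so position m separates the two
   kinds. *)
pose t := [seq z <- eigenvals A | predC on z] ++ line_eigenvals A y theta.
have At : perm_eq (eigenvals A) t.
  by rewrite /t perm_sym perm_catC (perm_filterC on).
have [U uU dU] := normalmx_diagonalize nA At.
set d := \row_i t`_i in dU.
set p := nb_line A y theta; set m := (n - p)%N.
have e : (m + p = n)%N by rewrite subnK // nb_line_le.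
have size_off : size [seq z <- eigenvals A | predC on z] = m.
  rewrite size_filter /m -[n in (n - _)%N](size_eigenvals A) -(count_predC on).
  by rewrite /p /nb_line size_filter addKn.
have size_t : size t = n by rewrite -(perm_size At) size_eigenvals.
have dP k : (d 0 k \in line y theta) = (m <= k)%N.
  rewrite mxE /t nth_cat size_off ltnNge; case: leqP => /= [le_mk|lt_km].
    have : (line_eigenvals A y theta)`_(k - m) \in line_eigenvals A y theta.
      by rewrite mem_nth // -/(nb_line A y theta) ltn_subLR // e.
    by rewrite mem_filter => /andP[].
  have : [seq z <- eigenvals A | predC on z]`_k \in
      [seq z <- eigenvals A | predC on z] by rewrite mem_nth // size_off.
  by rewrite mem_filter => /andP[/negPf].
pose U1 := block_mx U 0 0 1%:M : 'M[R[i]]_(n + 1).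
have M1E : U1^t* *m bordered A v w y *m U1 =
    block_mx (diag_mx d) (theta *: (U^t* *m x)) (theta *: (U^t* *m x)^t*) y%:M.
  rewrite block1_conj dU trmxC_mul trmxCK wE [in U^t* *m v]vE.
  by rewrite -scalemxAl -scalemxAr.
(* The vanishing of the off-line coordinates is derived in the eigenbasis; normality is carried
   there by unitary conjugation. *)
have offline := @bordered_normal_offline R n d (U^t* *m x) y theta th1.
rewrite -M1E normalmx_conj in offline; last exact: block1_unitary.
have [B [D [r [dB offB dD AE ME]]]] :=
  arrow_diag e (arrow_size (nb_line_le A y theta)) th1 dP (offline nM).
exists U, B, D, r; split=> //; last by rewrite M1E -ME.
  by move=> j; exact: unitary_diag_eigenvector uU dU.
split=> //.
(* The spectrum of A splits into those of [B] and [Lambda]; filtering by the line removes all of the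
   former and keeps all of the latter. *)
have AB : perm_eq (eigenvals A) (eigenvals B ++ eigenvals (Lambda y theta D)).
  rewrite -(permPr (perm_eigenvals_block_diag _ _)); apply: eq_eigenvals.
  by rewrite -(char_poly_castmx e) AE -dU char_poly_conj // (unitarymxP uU).
rewrite perm_sym /line_eigenvals (permPl (perm_filter _ AB)) filter_cat.
have -> : [seq z <- eigenvals B | z \in line y theta] = [::].
  by apply/eqP; rewrite -(negbK (_ == _)) -has_filter -all_predC.
by have /all_filterP -> := eigenvals_Lambda_line y theta dD.
Qed.

Lemma normal_form_normalmx n (A : 'M[R[i]]_n) (v w : 'cV[R[i]]_n)
    (y theta : R[i]) (U : 'M[R[i]]_n) (B : 'M[R[i]]_(n - nb_line A y theta))
    (D : 'M[R]_(nb_line A y theta)) (r : 'cV[R[i]]_(nb_line A y theta)) :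
  normal_form v w U B D r -> bordered A v w y \is normalmx.
Proof.
case=> uU _ dB [dD _] ME; rewrite -(normalmx_conj _ (block1_unitary uU)) ME.
by rewrite normalmx_castmx arrow_normalmx.
Qed.

End NormalForm.

(** * The equivalence, and interlacing on the line *)

Theorem theorem3p3 (R : realType) (n : nat) (A : 'M[R[i]]_n)
    (v w : 'cV[R[i]]_n) (y : R[i]) (hA : A \is normalmx) :
  (bordered A v w y \is normalmx <->
   exists theta : R[i], TU theta /\
     exists (U : 'M[R[i]]_n)
            (B : 'M[R[i]]_(n - nb_line A y theta))
            (D : 'M[R]_(nb_line A y theta))
            (r : 'cV[R[i]]_(nb_line A y theta)),
       normal_form v w U B D r)
  /\
  (forall (theta : R[i]) (U : 'M[R[i]]_n)
          (B : 'M[R[i]]_(n - nb_line A y theta))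
          (D : 'M[R]_(nb_line A y theta))
          (r : 'cV[R[i]]_(nb_line A y theta)),
     TU theta -> normal_form v w U B D r ->
     exists (rr : 'I_(nb_line A y theta) -> R)
            (ss : 'I_(nb_line A y theta).+1 -> R),
       [/\ perm_eq (eigenvals A)
             (eigenvals B ++ [seq y + theta * (rr j)%:C | j <- enum 'I_(nb_line A y theta)]),
           perm_eq (eigenvals (bordered A v w y))
             (eigenvals B ++ [seq y + theta * (ss j)%:C | j <- enum 'I_(nb_line A y theta).+1]),
           forall i j : 'I_(nb_line A y theta), (i <= j)%N -> rr i <= rr j
         & interlaced ss rr]).
Proof.
split.
  split; first exact: bordered_normal_form.
  by case=> theta [_ [U [B [D [r nf]]]]]; exact: normal_form_normalmx nf.
move=> theta U B D r _ [uU _ dB [dD _] ME].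
(* Interlacing is applied to the Hermitian factor [border D r], whose leading block is the real
   diagonal [D]. *)
have [a [b [pa pb sa ab]]] := cauchy_interlacing (border_trC r dD).
rewrite border_ulsubmx in pa.
have size_a : size a = nb_line A y theta.
  by rewrite -(size_map (real_complex R)) -(perm_size pa) size_eigenvals.
have size_b : size b = (nb_line A y theta).+1.
  by rewrite -(size_map (real_complex R)) -(perm_size pb) size_eigenvals addn1.
exists (fun j => a`_j), (fun j => b`_j); split.
- rewrite (map_enum_nth 0 (fun z => y + theta * z%:C) size_a).
  rewrite (map_comp (fun z => y + theta * z) (real_complex R)).
  have nD : map_mx (real_complex R) D \is normalmx.
    by apply/normalmxP; rewrite diag_real_trC.
  (* The map z -> y + [theta] z carries the spectrum of [D] to that of [Lambda]. *)
  have := eigenvals_affine theta y nD.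
  rewrite (permPr (perm_map _ pa)) => pL.
  rewrite -(permPr (perm_cat (perm_refl _) pL)).
  rewrite -(permPr (perm_eigenvals_block_diag _ _)); apply: eq_eigenvals.
  rewrite -(char_poly_conj A (unitarymxP uU)).
  rewrite (bordered_castmx (subnK (nb_line_le A y theta)) ME).
  by rewrite char_poly_castmx.
- rewrite (map_enum_nth 0 (fun z => y + theta * z%:C) size_b).
  rewrite (map_comp (fun z => y + theta * z) (real_complex R)).
  have nH : border D r \is normalmx by apply/normalmxP; rewrite border_trC.
  (* The same map carries the spectrum of [border D r] to that of the trailing block, which with [B]
     makes up the spectrum of the bordered matrix. *)
  have := eigenvals_affine theta y nH.
  rewrite (permPr (perm_map _ pb)) => pL.
  rewrite -(permPr (perm_cat (perm_refl _) pL)).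
  rewrite -(permPr (eigenvals_arrow _ _ _ _ _)); apply: eq_eigenvals.
  rewrite -(char_poly_conj _ (unitarymxP (block1_unitary uU))).
  by rewrite ME char_poly_castmx.
- move=> i j le_ij; apply: (le_sorted_leq_nth 0 sa); rewrite ?inE ?size_a //.
- by move=> j; exact: (ab j (ltn_ord j)).
Qed.
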